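(* Let $\mathcal{R}M=D\mathcal{C}$ be a proper U-match decomposition of $D\in\mathbb{K}^{m\times n}$. Given direct access to the rows and columns of $(\mathcal{R}_{\rho\rho})^{-1}$, $M$, and $D$: 1. each of the following can be obtained with no triangular solves: any row of $\mathcal{C}^{-1}$, any column of $\mathcal{C}^{-1}$, and any row of $(\mathcal{R}^{-1})_{\rho\mathbf{m}}$; 2. each of the following can be obtained with at most one triangular solve: any row or column of $\mathcal{C}$, any row or column of $\mathcal{R}$, and any column of $\mathcal{R}^{-1}$.
   Context: $\mathbb{K}$ is a field; $\mathbf{m}=(1,\dots,m)$. $D_{\sigma\tau}$ is the submatrix of $D$ with rows $\sigma$ and columns $\tau$ (in the listed orders). A (generalized) matching matrix is a matrix with at most one nonzero entry in each row and each column. A U-match decomposition of $D\in\mathbb{K}^{m\times n}$ is a tuple $(\mathcal{R},M,D,\mathcal{C})$ with $\mathcal{R}M=D\mathcal{C}$, where $M\in\mathbb{K}^{m\times n}$ is a matching matrix and $\mathcal{R}\in\mathbb{K}^{m\times m}$, $\mathcal{C}\in\mathbb{K}^{n\times n}$ are upper unitriangular (upper triangular with ones on the diagonal). $\rho$ is the increasing sequence of row indices $r$ with $\mathrm{row}_r(M)\neq 0$, and $\kappa$ the increasing sequence of column indices $c$ with $\mathrm{col}_c(M)\ne 0$. The decomposition is proper if (A1) whenever $\mathrm{col}_k(M)=0$, $\mathrm{row}_k(\mathcal{C})$ is the $k$th standard unit row vector; and (A2) whenever $\mathrm{row}_k(M)=0$, $\mathrm{col}_k(\mathcal{R})$ is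 the $k$th standard unit column vector. Cost model. Besides triangular solves, the permitted operations are: reading rows and columns of the accessible matrices, multiplying vectors by submatrices of the accessible matrices or by the inverse of the generalized permutation matrix $M_{\rho\kappa}$, reindexing/permuting entries, concatenating vectors, negating, and inserting entries equal to 0 or 1. A triangular solve (one application of back-substitution) means solving one linear system $Tx=b$ or $yT=c$, where $T$ is an invertible matrix that is triangular up to a permutation of rows and columns, and $T$ is either an accessible matrix or $T=(\mathcal{R}_{\rho\rho})^{-1}D_{\rho\kappa}$, the latter being available lazily because its rows and columns are products of accessible data. Solving a system with $D_{\rho\kappa} = \mathcal{R}_{\rho\rho}\cdot\big((\mathcal{R}_{\rho\rho})^{-1}D_{\rho\kappa}\big)$ counts as one triangular solve, since it reduces to a system with $(\mathcal{R}_{\rho\rho})^{-1}D_{\rho\kappa}$ together with multiplication by $(\mathcal{R}_{\rho\rho})^{-1}$. *)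

(* Defs.v *)
From mathcomp Require Import all_boot all_fingroup all_algebra.

Set Implicit Arguments.
Unset Strict Implicit.
Unset Printing Implicit Defensive.

Import GRing.Theory.
Local Open Scope ring_scope.

(** * Proper U-match decompositions *)

Definition matching_mx (K : fieldType) m n (M : 'M[K]_(m, n)) : Prop :=
  (forall i j j', M i j != 0 -> M i j' != 0 -> j = j') /\
  (forall i i' j, M i j != 0 -> M i' j != 0 -> i = i').

Definition upper_unitriangular (K : fieldType) n (A : 'M[K]_n) : Prop :=
  (forall i j : 'I_n, (j < i)%N -> A i j = 0) /\ (forall i, A i i = 1).

Record umatch (K : fieldType) m n
    (R : 'M[K]_m) (M D : 'M[K]_(m, n)) (C : 'M[K]_n) : Prop := UMatch {
  umatch_eq : R *m M = D *m C;
  umatch_matching : matching_mx M;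
  umatch_R : upper_unitriangular R;
  umatch_C : upper_unitriangular C
}.

Record proper_umatch (K : fieldType) m n
    (R : 'M[K]_m) (M D : 'M[K]_(m, n)) (C : 'M[K]_n) : Prop := ProperUMatch {
  proper_umatch_umatch : umatch R M D C;
  proper_umatch_C : forall k, col k M = 0 -> row k C = delta_mx 0 k;
  proper_umatch_R : forall k, row k M = 0 -> col k R = delta_mx k 0
}.

Definition increasing r m (f : 'I_r -> 'I_m) : Prop :=
  forall i j : 'I_r, (i < j)%N -> (f i < f j)%N.

(* [rho] (resp. [kappa]) lists in increasing order the indices of the nonzero
   rows (resp. columns) of [M]. For a matching matrix the two lists have the
   same length [r]: see [pivots_exist] below. *)
Record pivots (K : fieldType) m n r (M : 'M[K]_(m, n))
    (rho : 'I_r -> 'I_m) (kappa : 'I_r -> 'I_n) : Prop := Pivots {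
  pivots_rho_incr : increasing rho;
  pivots_kappa_incr : increasing kappa;
  pivots_rho : forall i, row i M != 0 <-> exists k, rho k = i;
  pivots_kappa : forall j, col j M != 0 <-> exists k, kappa k = j
}.

Lemma enum_val_increasing m (A : {set 'I_m}) :
  increasing (fun k : 'I_#|A| => enum_val k).
Proof.
move=> i j ij.
have srt : sorted ltn (map val (enum A)).
  rewrite -[enum _](eq_filter (mem_enum _)).
  rewrite -(eq_filter (mem_map val_inj _)) -filter_map.
  by rewrite (sorted_filter ltn_trans) // unlock val_ord_enum iota_ltn_sorted.
have sz (k : 'I_#|A|) : (k < size (enum A))%N by rewrite -cardE.
have := sorted_ltn_nth ltn_trans 0%N srt i j.
rewrite !inE size_map !sz => /(_ isT isT ij).
rewrite !(nth_map (enum_default i)) //.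
by rewrite /enum_val (set_nth_default (enum_default i) (enum_default j)) ?sz.
Qed.

Lemma pivots_exist (K : fieldType) m n (M : 'M[K]_(m, n)) :
  matching_mx M ->
  exists r (rho : 'I_r -> 'I_m) (kappa : 'I_r -> 'I_n), pivots M rho kappa.
Proof.
move=> [Mrow Mcol].
pose A := [set i | row i M != 0]; pose B := [set j | col j M != 0].
have inA i : i \in A -> exists j, M i j != 0.
  rewrite inE => Mi; apply/existsP; apply: contraR Mi.
  rewrite negb_exists => /forallP M0; apply/eqP/rowP => j; rewrite !mxE.
  by apply/eqP; move: (M0 j); rewrite negbK.
have inB j : j \in B -> exists i, M i j != 0.
  rewrite inE => Mj; apply/existsP; apply: contraR Mj.
  rewrite negb_exists => /forallP M0; apply/eqP/colP => i; rewrite !mxE.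
  by apply/eqP; move: (M0 i); rewrite negbK.
have MA i j : M i j != 0 -> i \in A.
  by rewrite inE; apply: contra_neq => /rowP/(_ j); rewrite !mxE.
have MB i j : M i j != 0 -> j \in B.
  by rewrite inE; apply: contra_neq => /colP/(_ i); rewrite !mxE.
have cardAB : #|A| = #|B|.
  pose f i := [pick j | M i j != 0].
  have fE i j : M i j != 0 -> f i = Some j.
    rewrite /f => Mij; case: pickP => [j' /Mrow/(_ Mij) -> //|/(_ j)].
    by rewrite Mij.
  have /card_in_imset <- : {in A &, injective f}.
    move=> i i' /inA[j Mij] /inA[j' Mij'].
    rewrite (fE _ _ Mij) (fE _ _ Mij') => -[jj'].
    by apply: (Mcol i i' j) => //; rewrite jj'.
  rewrite -(card_imset B (@Some_inj _)); apply/eq_card => x.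
  apply/imsetP/imsetP => [[i /inA[j Mij] ->]|[j /inB[i Mij] ->]].
    by exists j; [exact: MB Mij | exact: fE].
  by exists i; [exact: MA Mij | rewrite (fE _ _ Mij)].
exists #|A|, (fun k => enum_val k), (fun k => enum_val (cast_ord cardAB k)).
split.
- exact: enum_val_increasing.
- by move=> i j ij; apply: enum_val_increasing.
- move=> i; split=> [Ai|[k <-]]; last by have := enum_valP k; rewrite inE.
  have {}Ai : i \in A by rewrite inE.
  by exists (enum_rank_in Ai i); rewrite enum_rankK_in.
- move=> j; split=> [Bj|[k <-]].
    have {}Bj : j \in B by rewrite inE.
    exists (cast_ord (esym cardAB) (enum_rank_in Bj j)).
    by rewrite cast_ordKV enum_rankK_in.
  by have := enum_valP (cast_ord cardAB k); rewrite inE.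
Qed.

(* Up to permutations, lower and upper triangular mean the same thing. *)
Definition triangular_up_to_perm (K : fieldType) d (T : 'M[K]_d) : Prop :=
  exists s t : 'S_d, is_trig_mx (row_perm s (col_perm t T)).

(** * Cost model

    Computations are straight-line programs over vector registers. The syntax
    contains no scalar of [K], and a program is run on the three matrices
    [Rinv] = (R_{rho rho})^{-1}, [M] and [D] only, so that a program can neither
    be tailored to the entries of these matrices nor read [R] and [C]. *)

Section Syntax.
Variables m n r : nat.

Inductive accessible : nat -> nat -> Type :=
| AccRinv : accessible r r
| AccM : accessible m n
| AccD : accessible m n.

(* The matrices of triangular solves: an accessible square matrix,
   (R_{rho rho})^{-1} D_{rho kappa}, or D_{rho kappa}. *)
Inductive solvable : nat -> Type :=
| SolveAcc d : accessible d d -> solvable d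
| SolveRinvD : solvable r
| SolveD : solvable r.

(* [G] lists the lengths of the vectors computed so far, the latest first;
   [var G a] is the type of references to those of length [a]. *)
Inductive var : seq nat -> nat -> Type :=
| VarHere a G : var (a :: G) a
| VarThere a b G : var G a -> var (b :: G) a.

(* [op G a] is an operation returning a vector of length [a]. Inserting entries
   0 and 1 is concatenating with an [OpConst] and reindexing. *)
Inductive op (G : seq nat) : nat -> Type :=
| OpRow a b (A : accessible a b) (i : 'I_a) : op G b
| OpCol a b (A : accessible a b) (j : 'I_b) : op G a
| OpMulCol a b p q (A : accessible a b) (s : 'I_p -> 'I_a) (t : 'I_q -> 'I_b)
    (s_inj : injective s) (t_inj : injective t) (x : var G q) : op G p
| OpMulRow a b p q (A : accessible a b) (s : 'I_p -> 'I_a) (t : 'I_q -> 'I_b)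
    (s_inj : injective s) (t_inj : injective t) (y : var G p) : op G q
| OpInvMCol (x : var G r) : op G r
| OpInvMRow (y : var G r) : op G r
| OpReindex a b (f : 'I_b -> 'I_a) (x : var G a) : op G b
| OpCat a b (x : var G a) (y : var G b) : op G (a + b)
| OpNeg a (x : var G a) : op G a
| OpConst a (e : 'I_a -> bool) : op G a
| OpSolveCol d (T : solvable d) (b : var G d) : op G d
| OpSolveRow d (T : solvable d) (c : var G d) : op G d.

Inductive prog : seq nat -> nat -> Type :=
| Return G d : var G d -> prog G d
| Bind G a d : op G a -> prog (a :: G) d -> prog G d.

Definition op_solves G a (o : op G a) : nat :=
  match o with
  | OpSolveCol _ _ _ | OpSolveRow _ _ _ => 1
  | _ => 0
  end.

Fixpoint solves G d (p : prog G d) : nat :=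
  match p with
  | Return _ _ _ => 0
  | Bind _ _ _ o p' => (op_solves o + solves p')%N
  end.

End Syntax.

Section Semantics.
Variables (K : fieldType) (m n r : nat).
Variables (rho : 'I_r -> 'I_m) (kappa : 'I_r -> 'I_n).
Variables (Rinv : 'M[K]_r) (M D : 'M[K]_(m, n)).

Definition accessible_mx a b (A : accessible m n r a b) : 'M[K]_(a, b) :=
  match A with
  | AccRinv => Rinv
  | AccM => M
  | AccD => D
  end.

Definition solvable_mx d (T : solvable m n r d) : 'M[K]_d :=
  match T with
  | SolveAcc _ A => accessible_mx A
  | SolveRinvD => Rinv *m mxsub rho kappa D
  | SolveD => mxsub rho kappa D
  end.

Definition back_substitutable d (T : 'M[K]_d) : Prop :=
  T \in unitmx /\ triangular_up_to_perm T.

(* D_{rho kappa} itself need not be triangular up to permutation: solving with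
   it amounts to solving with (R_{rho rho})^{-1} D_{rho kappa}. *)
Definition legal_solve d (T : solvable m n r d) : Prop :=
  match T with
  | SolveAcc _ A => back_substitutable (accessible_mx A)
  | SolveRinvD | SolveD => back_substitutable (Rinv *m mxsub rho kappa D)
  end.

(* Row and column vectors are both stored as row vectors. *)
Fixpoint env (G : seq nat) : Type :=
  if G is a :: G' then ('rV[K]_a * env G')%type else unit.

Fixpoint lookup G d (x : var G d) : env G -> 'rV[K]_d :=
  match x with
  | VarHere _ _ => fun e => e.1
  | VarThere _ _ _ x' => fun e => lookup x' e.2
  end.

Definition eval_op G (e : env G) a (o : op m n r G a) : 'rV[K]_a :=
  match o with
  | OpRow _ _ A i => row i (accessible_mx A)
  | OpCol _ _ A j => (col j (accessible_mx A))^T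
  | OpMulCol _ _ _ _ A s t _ _ x =>
      (mxsub s t (accessible_mx A) *m (lookup x e)^T)^T
  | OpMulRow _ _ _ _ A s t _ _ y => lookup y e *m mxsub s t (accessible_mx A)
  | OpInvMCol x => (invmx (mxsub rho kappa M) *m (lookup x e)^T)^T
  | OpInvMRow y => lookup y e *m invmx (mxsub rho kappa M)
  | OpReindex _ _ f x => colsub f (lookup x e)
  | OpCat _ _ x y => row_mx (lookup x e) (lookup y e)
  | OpNeg _ x => - lookup x e
  | OpConst _ c => \row_j (c j)%:R
  | OpSolveCol _ T b => (invmx (solvable_mx T) *m (lookup b e)^T)^T
  | OpSolveRow _ T c => lookup c e *m invmx (solvable_mx T)
  end.

Definition legal_op G a (o : op m n r G a) : Prop :=
  match o with
  | OpSolveCol _ T _ | OpSolveRow _ T _ => legal_solve T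
  | _ => True
  end.

Fixpoint eval G d (p : prog m n r G d) : env G -> 'rV[K]_d :=
  match p with
  | Return _ _ x => fun e => lookup x e
  | Bind _ _ _ o p' => fun e => eval p' (eval_op e o, e)
  end.

Fixpoint legal G d (p : prog m n r G d) : Prop :=
  match p with
  | Return _ _ _ => True
  | Bind _ _ _ o p' => legal_op o /\ legal p'
  end.

End Semantics.

(* [target R C] can be obtained with at most [s] triangular solves. One program
   must serve all decompositions with pivot indices [rho] and [kappa]: for a
   single decomposition the claim would be void over 'F_2, where every vector
   is made of inserted entries 0 and 1. *)
Definition obtainable (K : fieldType) m n r
    (rho : 'I_r -> 'I_m) (kappa : 'I_r -> 'I_n) (s d : nat)
    (target : 'M[K]_m -> 'M[K]_n -> 'rV[K]_d) : Prop :=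
  exists p : prog m n r [::] d, (solves p <= s)%N /\
    forall R M D C, proper_umatch R M D C -> pivots M rho kappa ->
      let Rinv := invmx (mxsub rho rho R) in
      legal rho kappa Rinv M D p /\ eval rho kappa Rinv M D p tt = target R C.

(* Main.v *)
Require Import Defs.
From mathcomp Require Import all_boot all_fingroup all_algebra.

(* With respect to the splitting into pivot and non-pivot indices, properness
   makes [R] block lower triangular and [C] block upper triangular, with an
   identity as non-pivot diagonal block. Comparing blocks in [R M = D C], where
   only the block [M_{rho kappa}] is nonzero, expresses everything through
   [A = (R_{rho rho})^{-1} D_{rho kappa} = M_{rho kappa} (C^{-1})_{kappa kappa}]:
   the rows [kappa] of [C^{-1}] are
   [M_{rho kappa}^{-1} (R_{rho rho})^{-1} D_{rho .}], the columns [rho] of [R]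
   are [D_{. kappa} A^{-1}], and the remaining blocks of [C] and [R^{-1}] follow
   from these. The second expression for [A] shows that it is triangular up to
   permutation. *)

Set Implicit Arguments.
Unset Strict Implicit.
Unset Printing Implicit Defensive.

Import GRing.Theory.
Local Open Scope ring_scope.

(** * Submatrices along injections *)

Lemma increasing_inj r m (f : 'I_r -> 'I_m) : increasing f -> injective f.
Proof.
move=> f_incr i j fij; apply/val_inj; case: (ltngtP i j) => // /f_incr.
  by rewrite fij ltnn.
by rewrite fij ltnn.
Qed.

Lemma col_rowsub (T : Type) m n p (f : 'I_p -> 'I_m) (A : 'M[T]_(m, n)) j :
  col j (rowsub f A) = rowsub f (col j A).
Proof. by apply/matrixP => i k; rewrite !mxE. Qed.

Lemma row_colsub (T : Type) m n p (f : 'I_p -> 'I_n) (A : 'M[T]_(m, n)) i :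
  row i (colsub f A) = colsub f (row i A).
Proof. by apply/matrixP => k j; rewrite !mxE. Qed.

(** The hypothesis bears on products of entries, so the vanishing outside [f] may come from either
    factor; both cases occur below. *)
Lemma mulmx_support (R : pzSemiRingType) m p q r (f : 'I_r -> 'I_p)
    (X : 'M[R]_(m, p)) (Y : 'M[R]_(p, q)) :
  injective f ->
  (forall i j l, j \notin codom f -> X i j * Y j l = 0) ->
  X *m Y = colsub f X *m rowsub f Y.
Proof.
move=> f_inj XY0; apply/matrixP => i l; rewrite !mxE (bigID (mem (codom f))) /=.
rewrite [X in _ + X]big1 ?addr0 => [|j /XY0 //].
rewrite -(@big_uniq _ _ _ _ (codom f)) /=; last first.
  by rewrite map_inj_uniq ?enum_uniq.
by rewrite big_map big_enum /=; apply: eq_bigr => k _; rewrite !mxE.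
Qed.

(** * Matrices that agree with the identity outside an index set *)

Section IdentityOff.
Variables (K : fieldType) (p r : nat) (f : 'I_r -> 'I_p).
Hypothesis f_inj : injective f.

Definition identity_rows_off (U : 'M[K]_p) : Prop :=
  forall i j, i \notin codom f -> U i j = (i == j)%:R.

Definition identity_cols_off (U : 'M[K]_p) : Prop :=
  forall i j, j \notin codom f -> U i j = (i == j)%:R.

Lemma identity_cols_off_tr (U : 'M[K]_p) :
  identity_cols_off U -> identity_rows_off U^T.
Proof. by move=> Uid i j fi; rewrite mxE Uid // eq_sym. Qed.

(** If [e_i U = e_i], then multiplying by the inverse on the right gives [e_i = e_i U^{-1}]. *)
Lemma identity_rows_off_inv (U : 'M[K]_p) :
  U \in unitmx -> identity_rows_off U -> identity_rows_off (invmx U).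
Proof.
move=> Uu Uid i j fi.
have rowU : row i U = row i 1%:M by apply/rowP => l; rewrite !mxE Uid.
have : row i (invmx U) = row i 1%:M.
  by rewrite -[invmx U in LHS]mul1mx row_mul -rowU -row_mul mulmxV.
by move=> /rowP/(_ j); rewrite !mxE.
Qed.

Lemma identity_cols_off_inv (U : 'M[K]_p) :
  U \in unitmx -> identity_cols_off U -> identity_cols_off (invmx U).
Proof.
move=> Uu /identity_cols_off_tr Uid i j fj.
have := identity_rows_off_inv _ Uid i fj.
by rewrite unitmx_tr -trmx_inv mxE eq_sym; apply.
Qed.

(** A row of [U] outside [f] is a unit vector whose 1 sits outside [f], so it contributes nothing to
    the columns [f]. *)
Lemma colsub_mulmx_off q (X : 'M[K]_(q, p)) (U : 'M[K]_p) :
  identity_rows_off U ->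
  colsub f (X *m U) = colsub f X *m mxsub f f U.
Proof.
move=> Uid; rewrite -mulmx_colsub (mulmx_support f_inj) => [|i j l fj].
  by congr (_ *m _); apply/matrixP => i j; rewrite !mxE.
rewrite [colsub _ _ _ _]mxE Uid // (_ : j == f l = false) ?mulr0 //.
by apply: contraNF fj => /eqP->; apply: codom_f.
Qed.

Lemma rowsub_mulmx_off q (U : 'M[K]_p) (X : 'M[K]_(p, q)) :
  identity_cols_off U ->
  rowsub f (U *m X) = mxsub f f U *m rowsub f X.
Proof.
move=> /identity_cols_off_tr Uid; apply: trmx_inj.
by rewrite trmx_mul !trmx_mxsub trmx_mul colsub_mulmx_off.
Qed.

(** Restricting [U^{-1} U = 1] to the columns [f] factors through the block of [U]; restricting to
    the rows [f] then leaves a product of two square blocks equal to 1. *)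
Lemma mxsub_invmx_rows_off (U : 'M[K]_p) :
    U \in unitmx -> identity_rows_off U ->
  mxsub f f U \in unitmx /\ invmx (mxsub f f U) = mxsub f f (invmx U).
Proof.
move=> Uu Uid.
have VU : mxsub f f (invmx U) *m mxsub f f U = 1%:M.
  have := colsub_mulmx_off (invmx U) Uid; rewrite mulVmx // => /(congr1 (rowsub f)).
  rewrite -mul_rowsub_mx => H; apply: etrans (etrans (esym H) _).
    by congr (_ *m _); apply/matrixP => i j; rewrite !mxE.
  by apply/matrixP => i j; rewrite !mxE inj_eq.
have [_ Uff] := mulmx1_unit VU; split=> //.
by rewrite -[LHS]mul1mx -VU mulmxK.
Qed.

Lemma mxsub_invmx_cols_off (U : 'M[K]_p) :
    U \in unitmx -> identity_cols_off U ->
  mxsub f f U \in unitmx /\ invmx (mxsub f f U) = mxsub f f (invmx U).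
Proof.
rewrite -unitmx_tr => Uu /identity_cols_off_tr Uid.
have [] := mxsub_invmx_rows_off Uu Uid.
rewrite -trmx_mxsub unitmx_tr -!trmx_inv -trmx_mxsub => ? /trmx_inj ->.
by split.
Qed.

(* The off-diagonal block of [1 - U = U *m (invmx U - 1)], where the second
   factor has no nonzero row outside [f]. *)
Lemma col_rowsub_off (U : 'M[K]_p) j :
    U \in unitmx -> identity_rows_off U -> j \notin codom f ->
  col j (rowsub f U) = - (mxsub f f U *m col j (rowsub f (invmx U))).
Proof.
move=> Uu Uid fj; apply/eqP; rewrite -eqr_oppLR eq_sym; apply/eqP.
have /(congr1 (fun X => col j (rowsub f X))) : U *m (invmx U - 1%:M) = 1%:M - U.
  by rewrite mulmxBr mulmx1 mulmxV.
rewrite (mulmx_support f_inj) => [|i k l fk]; last first.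
  by rewrite !mxE (identity_rows_off_inv Uu Uid) // subrr mulr0.
have fkj k : f k == j = false.
  by apply: contraNF fj => /eqP <-; apply: codom_f.
move=> /matrixP E; apply/matrixP => i k; move: (E i k); rewrite !mxE fkj sub0r => <-.
by apply: eq_bigr => l _; rewrite !mxE fkj subr0.
Qed.

Lemma row_colsub_off (U : 'M[K]_p) i :
    U \in unitmx -> identity_cols_off U -> i \notin codom f ->
  row i (colsub f U) = - (row i (colsub f (invmx U)) *m mxsub f f U).
Proof.
rewrite -unitmx_tr => Uu /identity_cols_off_tr Uid fi; apply: trmx_inj.
by rewrite tr_row trmx_mxsub col_rowsub_off // linearN /= trmx_mul tr_row
  !trmx_mxsub trmx_inv.
Qed.

End IdentityOff.

(** * Unitriangular matrices and triangularity up to permutation *)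

Lemma upper_unitriangular_unit (K : fieldType) n (U : 'M[K]_n) :
  upper_unitriangular U -> U \in unitmx.
Proof.
move=> [U0 U1]; rewrite -unitmx_tr unitmxE det_trig.
  by rewrite big1 ?unitr1 // => i _; rewrite mxE U1.
by apply/is_trig_mxP => i j ij; rewrite mxE U0.
Qed.

Lemma upper_unitriangular_inv (K : fieldType) n (U : 'M[K]_n) :
  upper_unitriangular U -> upper_unitriangular (invmx U).
Proof.
move=> Uut; have [U0 U1] := Uut; have Uu := upper_unitriangular_unit Uut.
(* In entry [(i, j)] of [U^{-1} U = 1], the terms [k < j] vanish by assumption and the terms [k > j]
   because [U] is upper triangular; only [k = j] remains, with [U j j = 1]. *)
have VUE (i j : 'I_n) :
    (forall k : 'I_n, (k < j)%N -> invmx U i k = 0) -> invmx U i j = (i == j)%:R.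
  move=> V0; have /matrixP/(_ i j) := mulVmx Uu.
  rewrite !mxE (bigD1 j) //= U1 mulr1 big1 ?addr0 // => k kj.
  have [/V0 ->|/U0 ->|/val_inj kj'] := ltngtP k j; rewrite ?mul0r ?mulr0 //.
  by rewrite kj' eqxx in kj.
have V0 (i j : 'I_n) : (j < i)%N -> invmx U i j = 0.
  have [k] := ubnP (val j); elim: k => // k IHk in j *.
  rewrite ltnS => jk ji; rewrite VUE => [|l lj].
    by case: eqP ji => // ->; rewrite ltnn.
  by apply: IHk (ltn_trans lj ji); apply: leq_trans jk.
by split=> // i; rewrite VUE ?eqxx // => k /V0.
Qed.

Lemma upper_unitriangular_mxsub (K : fieldType) n r (f : 'I_r -> 'I_n)
    (U : 'M[K]_n) :
  increasing f -> upper_unitriangular U -> upper_unitriangular (mxsub f f U).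
Proof. by move=> f_incr [U0 U1]; split=> [i j /f_incr/U0|i]; rewrite mxE. Qed.

Lemma rev_perm_ltn n (i j : 'I_n) :
  (i < j)%N -> (perm (@rev_ord_inj n) j < perm (@rev_ord_inj n) i)%N.
Proof. by move=> ij; rewrite !permE /= ltn_sub2l ?ltnS // (leq_ltn_trans ij). Qed.

(* [A *m U], where row [i] of the matching matrix [A] has its nonzero entry in
   column [pi i], becomes lower triangular when its columns are reversed and its
   rows are sorted by decreasing [pi i]. *)
Lemma back_substitutable_matching (K : fieldType) r (A U : 'M[K]_r) (pi : 'S_r) :
    (forall i j, (A i j != 0) = (j == pi i)) -> upper_unitriangular U ->
  back_substitutable (A *m U) /\ A \in unitmx.
Proof.
move=> Api Uut; have [U0 _] := Uut.
have A0 i j : j != pi i -> A i j = 0 by rewrite -Api => /negbNE/eqP.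
have AE : A = diag_mx (\row_i A i (pi i)) *m perm_mx pi.
  apply/matrixP => i j; rewrite mul_diag_mx !mxE.
  by have [->|/A0->] := eqVneq j (pi i); rewrite ?mulr1 ?mulr0.
have Au : A \in unitmx.
  rewrite AE unitmx_mul unitmx_perm andbT unitmxE det_diag unitfE.
  by apply/prodf_neq0 => i _; rewrite mxE Api.
split=> //; split; first by rewrite unitmx_mul Au upper_unitriangular_unit.
pose rev := perm (@rev_ord_inj r).
(* Row [i] is now row [pi^-1 (rev i)] of [A], supported in column [rev i]. Entry [(i, j)] is thus a
   multiple of [U (rev i) (rev j)], which is 0 when [i < j]. *)
exists (rev * pi^-1)%g, rev; apply/is_trig_mxP => i j ij.
rewrite !mxE (bigD1 (rev i)) //= big1 => [|k ki]; last first.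
  by rewrite A0 ?mul0r // permM permKV.
by rewrite U0 ?mulr0 ?addr0 // rev_perm_ltn.
Qed.

(** * Block identities of a proper U-match decomposition *)

Section ProperUMatch.
Variables (K : fieldType) (m n r : nat).
Variables (rho : 'I_r -> 'I_m) (kappa : 'I_r -> 'I_n).
Variables (R : 'M[K]_m) (M D : 'M[K]_(m, n)) (C : 'M[K]_n).
Hypotheses (RMDC : proper_umatch R M D C) (piv : pivots M rho kappa).

Let rho_inj : injective rho := increasing_inj (pivots_rho_incr piv).
Let kappa_inj : injective kappa := increasing_inj (pivots_kappa_incr piv).

Let um := proper_umatch_umatch RMDC.
Let Ru : R \in unitmx := upper_unitriangular_unit (umatch_R um).
Let Cu : C \in unitmx := upper_unitriangular_unit (umatch_C um).

Local Notation Rinv := (invmx (mxsub rho rho R)).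
Local Notation A := (Rinv *m mxsub rho kappa D).

Lemma matching_row_off i j : i \notin codom rho -> M i j = 0.
Proof.
move=> ri; have [M0|/(pivots_rho piv) [k rk]] := eqVneq (row i M) 0.
  by have /rowP/(_ j) := M0; rewrite !mxE.
by rewrite -rk codom_f in ri.
Qed.

Lemma matching_col_off i j : j \notin codom kappa -> M i j = 0.
Proof.
move=> kj; have [M0|/(pivots_kappa piv) [k kk]] := eqVneq (col j M) 0.
  by have /colP/(_ i) := M0; rewrite !mxE.
by rewrite -kk codom_f in kj.
Qed.

(** Conditions (A1) and (A2) enter only here and in [proper_R_cols_off]. *)
Lemma proper_C_rows_off : identity_rows_off kappa C.
Proof.
move=> i j ki; have /rowP/(_ j) : row i C = delta_mx 0 i.
  by apply: (proper_umatch_C RMDC); apply/colP => l; rewrite !mxE matching_col_off.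
by rewrite !mxE eq_sym.
Qed.

Lemma proper_R_cols_off : identity_cols_off rho R.
Proof.
move=> i j rj; have /colP/(_ i) : col j R = delta_mx j 0.
  by apply: (proper_umatch_R RMDC); apply/rowP => l; rewrite !mxE matching_row_off.
by rewrite !mxE andbT.
Qed.

Lemma invmx_C_rows_off : identity_rows_off kappa (invmx C).
Proof. exact: identity_rows_off_inv proper_C_rows_off. Qed.

Lemma invmx_R_cols_off : identity_cols_off rho (invmx R).
Proof. exact: identity_cols_off_inv proper_R_cols_off. Qed.

(** The accessible inverse of a block is thereby a block of [R^{-1}], so its entries are genuine
    entries of [R^{-1}]. *)
Lemma RinvE : Rinv = mxsub rho rho (invmx R).
Proof. by have [] := mxsub_invmx_cols_off rho_inj Ru proper_R_cols_off. Qed.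

(** These are the rows [rho] of [M C^{-1} = R^{-1} D]: [M] has no entries outside the columns
    [kappa], and the rows [rho] of [R^{-1}] have none outside the columns [rho]. *)
Lemma matching_rowsub : mxsub rho kappa M *m rowsub kappa (invmx C)
  = Rinv *m rowsub rho D.
Proof.
rewrite RinvE -(rowsub_mulmx_off rho_inj _ invmx_R_cols_off).
have -> : invmx R *m D = M *m invmx C.
  by rewrite -[D](mulmxK Cu) -(umatch_eq um) !mulmxA mulVmx // mul1mx.
rewrite (mulmx_support kappa_inj) => [|i j l kj].
  by rewrite -mul_rowsub_mx; congr (_ *m _); apply/matrixP => i j; rewrite !mxE.
by rewrite matching_col_off // mul0r.
Qed.

Lemma matching_mxsub : mxsub rho kappa M *m mxsub kappa kappa (invmx C) = A.
Proof.
have /(congr1 (colsub kappa)) := matching_rowsub.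
by rewrite -!mulmx_colsub -!mxsub_comp.
Qed.

Lemma matching_perm :
  exists pi : 'S_r, forall i j, (mxsub rho kappa M i j != 0) = (j == pi i).
Proof.
have [Mrow Mcol] := umatch_matching um.
have ex i : exists j, M (rho i) (kappa j) != 0.
  apply/existsP; rewrite -[[exists _, _]]negbK negb_exists; apply/negP => /forallP M0.
  have /negP := (pivots_rho piv (rho i)).2 (ex_intro _ i erefl); apply.
  apply/eqP/rowP => j; rewrite !mxE.
  have [/codomP[k ->]|/matching_col_off-> //] := boolP (j \in codom kappa).
  by have := M0 k; rewrite negbK => /eqP.
pose pi i := xchoose (ex i).
have piP i : M (rho i) (kappa (pi i)) != 0 := xchooseP (ex i).
have pi_inj : injective pi.
  move=> i i' ii'; apply: rho_inj; apply: (Mcol _ _ _ (piP i)); rewrite ii'.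
  exact: piP.
exists (perm pi_inj) => i j; rewrite mxE permE.
apply/idP/eqP => [Mij|->]; last exact: piP.
exact/kappa_inj/(Mrow _ _ _ Mij)/piP.
Qed.

(** The first half makes every solve in the programs below legal; the second allows the pivot block
    of [M] to be cancelled. *)
Lemma A_back_substitutable : back_substitutable A /\ mxsub rho kappa M \in unitmx.
Proof.
have [pi piP] := matching_perm; rewrite -matching_mxsub.
apply: back_substitutable_matching piP _; apply: upper_unitriangular_mxsub.
  exact: pivots_kappa_incr piv.
exact/upper_unitriangular_inv/umatch_C/um.
Qed.

Let Au : A \in unitmx := proj1 (proj1 A_back_substitutable).
Let Mu := proj2 A_back_substitutable.

Lemma rowsub_invmx_C :
  rowsub kappa (invmx C) = invmx (mxsub rho kappa M) *m (Rinv *m rowsub rho D).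
Proof. by rewrite -matching_rowsub mulKmx. Qed.

Lemma mulmx_A_C : A *m mxsub kappa kappa C = mxsub rho kappa M.
Proof.
have [Ckk CkkV] := mxsub_invmx_rows_off kappa_inj Cu proper_C_rows_off.
by rewrite -matching_mxsub -CkkV mulmxKV.
Qed.

Lemma mxsub_C : mxsub kappa kappa C = invmx A *m mxsub rho kappa M.
Proof. by rewrite -mulmx_A_C mulKmx. Qed.

(** In [- C_{kappa kappa} (C^{-1})_{kappa j}] the pivot block of [M] cancels against its inverse,
    which leaves one solve with [A]. *)
Lemma col_C_off j : j \notin codom kappa ->
  col j (rowsub kappa C) = - (invmx A *m (Rinv *m col j (rowsub rho D))).
Proof.
move=> kj; rewrite (col_rowsub_off kappa_inj Cu proper_C_rows_off kj).
by rewrite mxsub_C rowsub_invmx_C !colE -!mulmxA mulKVmx.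
Qed.

(** The columns [kappa] of [R M = D C] involve only the pivot blocks of [M] and [C]; substituting
    [mxsub_C] lets that of [M] cancel on the right. *)
Lemma colsub_R : colsub rho R = colsub kappa D *m invmx A.
Proof.
have RM : colsub rho R *m mxsub rho kappa M = colsub kappa D *m mxsub kappa kappa C.
  rewrite -(colsub_mulmx_off kappa_inj _ proper_C_rows_off) -(umatch_eq um).
  rewrite (mulmx_support rho_inj) => [|i j l rj].
    by rewrite -mulmx_colsub; congr (_ *m _); apply/matrixP => i j; rewrite !mxE.
  by rewrite matching_row_off // mulr0.
by rewrite -[LHS](mulmxK Mu) RM mxsub_C !mulmxA mulmxK.
Qed.

(** This is [row_colsub_off] for [R^{-1}], whose inverse [R] has its columns [rho] given by
    [colsub_R]. *)
Lemma row_invmx_R_off i : i \notin codom rho ->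
  row i (colsub rho (invmx R)) = - (row i (colsub kappa D) *m invmx A *m Rinv).
Proof.
move=> ri; rewrite (row_colsub_off rho_inj _ invmx_R_cols_off ri) ?unitmx_inv //.
by rewrite invmxK colsub_R row_mul RinvE.
Qed.

End ProperUMatch.

(** * Straight-line programs for the rows and columns *)

Section Programs.
Variables (K : fieldType) (m n r : nat).
Variables (rho : 'I_r -> 'I_m) (kappa : 'I_r -> 'I_n).

Local Notation v0 := (VarHere _ _).
Local Notation v1 := (VarThere _ v0).
Local Notation v2 := (VarThere _ v1).
Local Notation v3 := (VarThere _ v2).
Local Notation "o >> p" := (Bind o p) (at level 60, right associativity).
Local Notation idI := (@inj_id _).
Local Notation ret := (Return m n r v0).
Local Notation const e := (OpConst m n r _ e).
Local Notation accRinv := (AccRinv m n r).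
Local Notation accM := (AccM m n r).
Local Notation accD := (AccD m n r).
Local Notation solveA := (SolveRinvD m n r).

(* Without injectivity there is no decomposition to serve, but the program has
   to exist all the same. *)
Lemma obtainable_inj s d (target : 'M[K]_m -> 'M[K]_n -> 'rV[K]_d) :
  (injective rho -> injective kappa -> obtainable rho kappa s target) ->
  obtainable rho kappa s target.
Proof.
move=> H; have [/andP[/injectiveP ri /injectiveP ki]|ninj] :=
  boolP (injectiveb rho && injectiveb kappa); first exact: H.
exists (const xpred0 >> ret); split=> // R M D C _ piv; case/negP: ninj.
apply/andP; split; apply/injectiveP/increasing_inj.
  exact: pivots_rho_incr piv.
exact: pivots_kappa_incr piv.
Qed.

Lemma eval_const d (i : 'I_d) : \row_j (j == i)%:R = delta_mx 0 i :> 'rV[K]_d.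
Proof. by apply/rowP => j; rewrite !mxE. Qed.

(** Reindexing the concatenation of [u] and [v] by this map overwrites the entries of [v] at the
    positions [f] by [u], so that pivot entries can be placed into a full-length vector of default
    values. *)
Definition scatter_index p (f : 'I_r -> 'I_p) (j : 'I_p) : 'I_(r + p) :=
  if [pick k | f k == j] is Some k then lshift p k else rshift r j.

Lemma colsub_scatter p (f : 'I_r -> 'I_p) (u : 'rV[K]_r) (v w : 'rV[K]_p) :
    injective f -> colsub f w = u ->
    (forall j, j \notin codom f -> w 0 j = v 0 j) ->
  colsub (scatter_index f) (row_mx u v) = w.
Proof.
move=> f_inj <- wv; apply/rowP => j; rewrite mxE /scatter_index.
case: pickP => [k /eqP <-|fj]; first by rewrite row_mxEl mxE.
by rewrite row_mxEr wv //; apply/codomP => -[k jk]; have := fj k; rewrite jk eqxx.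
Qed.

Definition scatter G p (f : 'I_r -> 'I_p) (x : var G r) (y : var G p) :
    prog m n r G p :=
  OpCat m n r x y >> OpReindex m n r (scatter_index f) v0 >> ret.

Lemma eval_scatter (Rinv : 'M[K]_r) (M D : 'M[K]_(m, n)) G (e : env K G) p
    (f : 'I_r -> 'I_p) (x : var G r) (y : var G p) (w : 'rV[K]_p) :
    injective f -> colsub f w = lookup x e ->
    (forall j, j \notin codom f -> w 0 j = lookup y e 0 j) ->
  eval rho kappa Rinv M D (scatter f x y) e = w.
Proof. exact: colsub_scatter. Qed.

Lemma obtainable_row_invmx_C i :
  obtainable rho kappa 0 (fun (R : 'M[K]_m) C => row i (invmx C)).
Proof.
apply: obtainable_inj => rho_inj kappa_inj.
(* This case distinction depends only on [kappa], which is fixed before the program is chosen. *)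
have [/codomP[k ->]|ki] := boolP (i \in codom kappa).
  exists (const (pred1 k) >> OpInvMRow m n v0 >> OpMulRow accRinv idI idI v0
    >> OpMulRow accD rho_inj idI v0 >> ret).
  split=> // R M D C RMDC piv; split=> //=.
  rewrite eval_const mxsub_id -!mulmxA -rowE -(rowsub_invmx_C RMDC piv).
  by rewrite row_rowsub.
exists (const (pred1 i) >> ret); split=> // R M D C RMDC piv; split=> //=.
by apply/rowP => j; rewrite !mxE (invmx_C_rows_off RMDC piv) // eq_sym.
Qed.

(** The pivot entries are computed from column [j] of [D]; the others are those of the unit vector
    [e_j]. *)
Lemma obtainable_col_invmx_C j :
  obtainable rho kappa 0 (fun (R : 'M[K]_m) C => (col j (invmx C))^T).
Proof.
apply: obtainable_inj => rho_inj kappa_inj.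
exists (OpCol _ accD j >> OpReindex m n r rho v0
  >> OpMulCol accRinv idI idI v0 >> OpInvMCol m n v0 >> const (pred1 j)
  >> scatter kappa v1 v0).
split=> // R M D C RMDC piv; split=> //; apply: eval_scatter => //= [|i ki].
  rewrite -!trmx_mxsub !trmxK mxsub_id -!col_rowsub (rowsub_invmx_C RMDC piv).
  by rewrite !colE !mulmxA.
by rewrite !mxE (invmx_C_rows_off RMDC piv) // eq_sym.
Qed.

Lemma obtainable_row_invmx_R k :
  obtainable rho kappa 0
    (fun R (C : 'M[K]_n) => row k (rowsub rho (invmx R))).
Proof.
apply: obtainable_inj => rho_inj kappa_inj.
exists (OpRow _ accRinv k >> const xpred0 >> scatter rho v1 v0).
split=> // R M D C RMDC piv; split=> //; apply: eval_scatter => //= [|i ri].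
  by rewrite (RinvE RMDC piv); apply/rowP => l; rewrite !mxE.
rewrite !mxE (invmx_R_cols_off RMDC piv) //.
by case: eqP ri => // <-; rewrite codom_f.
Qed.

Lemma obtainable_row_C i :
  obtainable rho kappa 1 (fun (R : 'M[K]_m) C => row i C).
Proof.
apply: obtainable_inj => rho_inj kappa_inj.
have [/codomP[k ->]|ki] := boolP (i \in codom kappa).
  (* The single solve gives [y = e_k A^{-1}], used twice: the pivot entries are [y M_{rho kappa}],
     the others those of [- y (R_{rho rho})^{-1} D_{rho .}]. *)
  exists (const (pred1 k) >> OpSolveRow solveA v0
    >> OpMulRow accM rho_inj kappa_inj v0 >> OpMulRow accRinv idI idI v1
    >> OpMulRow accD rho_inj idI v0 >> OpNeg m n r v0 >> scatter kappa v3 v0).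
  split=> // R M D C RMDC piv.
  have [Abs _] := A_back_substitutable RMDC piv; split=> //.
  apply: eval_scatter => //= [|j kj]; rewrite eval_const -?mulmxA -rowE.
    by rewrite -(mxsub_C RMDC piv); apply/rowP => l; rewrite !mxE.
  rewrite mxsub_id; have /colP/(_ k) := col_C_off RMDC piv kj.
  rewrite !mxE => ->; congr (- _); apply: eq_bigr => l _; rewrite !mxE.
  by congr (_ * _); apply: eq_bigr => l' _; rewrite !mxE.
exists (const (pred1 i) >> ret); split=> // R M D C RMDC piv; split=> //=.
by apply/rowP => j; rewrite !mxE (proper_C_rows_off RMDC piv) // eq_sym.
Qed.

Lemma obtainable_col_C j :
  obtainable rho kappa 1 (fun (R : 'M[K]_m) C => (col j C)^T).
Proof.
apply: obtainable_inj => rho_inj kappa_inj.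
have [/codomP[k ->]|kj] := boolP (j \in codom kappa).
  exists (OpCol _ accM (kappa k) >> OpReindex m n r rho v0 >> OpSolveCol solveA v0
    >> const (pred1 (kappa k)) >> scatter kappa v1 v0).
  split=> // R M D C RMDC piv.
  have [Abs _] := A_back_substitutable RMDC piv; split=> //.
  apply: eval_scatter => //= [|i ki]; last first.
    by rewrite !mxE (proper_C_rows_off RMDC piv) // eq_sym.
  have /(congr1 (col k)) := mxsub_C RMDC piv.
  rewrite [RHS]colE -mulmxA -colE -!trmx_mxsub !trmxK => E; congr _^T.
  by apply: etrans (etrans E _); [|congr (_ *m _)]; apply/colP => l; rewrite !mxE.
(* Outside [kappa], the only nonzero entry of the column is the 1 at position [j], supplied by
   [e_j]. *)
exists (OpCol _ accD j >> OpReindex m n r rho v0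
  >> OpMulCol accRinv idI idI v0 >> OpSolveCol solveA v0 >> OpNeg m n r v0
  >> const (pred1 j) >> scatter kappa v1 v0).
split=> // R M D C RMDC piv.
have [Abs _] := A_back_substitutable RMDC piv; split=> //.
apply: eval_scatter => //= [|i ki]; last first.
  by rewrite !mxE (proper_C_rows_off RMDC piv) // eq_sym.
rewrite -!trmx_mxsub !trmxK mxsub_id -!col_rowsub (col_C_off RMDC piv kj).
by rewrite linearN.
Qed.

(** Since [colsub_R] covers all rows at once, pivot and non-pivot [i] share one program. *)
Lemma obtainable_row_R i :
  obtainable rho kappa 1 (fun R (C : 'M[K]_n) => row i R).
Proof.
apply: obtainable_inj => rho_inj kappa_inj.
exists (OpRow _ accD i >> OpReindex m n r kappa v0 >> OpSolveRow solveA v0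
  >> const (pred1 i) >> scatter rho v1 v0).
split=> // R M D C RMDC piv.
have [Abs _] := A_back_substitutable RMDC piv; split=> //.
apply: eval_scatter => //= [|j rj].
  by rewrite -!row_colsub (colsub_R RMDC piv) row_mul.
by rewrite !mxE (proper_R_cols_off RMDC piv) // eq_sym.
Qed.

Lemma obtainable_col_R j :
  obtainable rho kappa 1 (fun R (C : 'M[K]_n) => (col j R)^T).
Proof.
apply: obtainable_inj => rho_inj kappa_inj.
have [/codomP[k ->]|rj] := boolP (j \in codom rho).
  exists (const (pred1 k) >> OpSolveCol solveA v0
    >> OpMulCol accD idI kappa_inj v0 >> ret).
  split=> // R M D C RMDC piv.
  have [Abs _] := A_back_substitutable RMDC piv; split=> //.
  rewrite /= eval_const trmx_delta trmxK mulmxA -(colsub_R RMDC piv) -colE.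
  by rewrite col_colsub.
exists (const (pred1 j) >> ret); split=> // R M D C RMDC piv; split=> //=.
by apply/rowP => i; rewrite !mxE (proper_R_cols_off RMDC piv).
Qed.

Lemma obtainable_col_invmx_R j :
  obtainable rho kappa 1 (fun R (C : 'M[K]_n) => (col j (invmx R))^T).
Proof.
apply: obtainable_inj => rho_inj kappa_inj.
have [/codomP[k ->]|rj] := boolP (j \in codom rho).
  (* Column [k] of [(R_{rho rho})^{-1}] serves twice: as the pivot entries ([v3]) and as the
     right-hand side of the solve that yields the other entries. *)
  exists (OpCol _ accRinv k >> OpSolveCol solveA v0
    >> OpMulCol accD idI kappa_inj v0 >> OpNeg m n r v0 >> scatter rho v3 v0).
  split=> // R M D C RMDC piv.
  have [Abs _] := A_back_substitutable RMDC piv; split=> //.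
  apply: eval_scatter => //= [|i ri].
    by rewrite (RinvE RMDC piv); apply/rowP => l; rewrite !mxE.
  rewrite !trmxK; have /rowP/(_ k) := row_invmx_R_off RMDC piv ri.
  rewrite -mulmxA !mxE => ->; congr (- _); apply: eq_bigr => l _; rewrite !mxE.
  by congr (_ * _); apply: eq_bigr => l' _; rewrite !mxE.
exists (const (pred1 j) >> ret); split=> // R M D C RMDC piv; split=> //=.
by apply/rowP => i; rewrite !mxE (invmx_R_cols_off RMDC piv).
Qed.

End Programs.

Theorem mainTheorem2 (K : fieldType) (m n r : nat)
    (rho : 'I_r -> 'I_m) (kappa : 'I_r -> 'I_n) :
  ((forall i : 'I_n,
      obtainable rho kappa 0 (fun (R : 'M[K]_m) C => row i (invmx C))) /\
   (forall j : 'I_n,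
      obtainable rho kappa 0 (fun (R : 'M[K]_m) C => (col j (invmx C))^T)) /\
   (forall k : 'I_r,
      obtainable rho kappa 0
        (fun R (C : 'M[K]_n) => row k (rowsub rho (invmx R)))))
  /\
  ((forall i : 'I_n,
      obtainable rho kappa 1 (fun (R : 'M[K]_m) C => row i C)) /\
   (forall j : 'I_n,
      obtainable rho kappa 1 (fun (R : 'M[K]_m) C => (col j C)^T)) /\
   (forall i : 'I_m,
      obtainable rho kappa 1 (fun R (C : 'M[K]_n) => row i R)) /\
   (forall j : 'I_m,
      obtainable rho kappa 1 (fun R (C : 'M[K]_n) => (col j R)^T)) /\
   (forall j : 'I_m,
      obtainable rho kappa 1 (fun R (C : 'M[K]_n) => (col j (invmx R))^T))).
Proof.
split.
  split; first exact: obtainable_row_invmx_C.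
  split; first exact: obtainable_col_invmx_C.
  exact: obtainable_row_invmx_R.
split; first exact: obtainable_row_C.
split; first exact: obtainable_col_C.
split; first exact: obtainable_row_R.
split; first exact: obtainable_col_R.
exact: obtainable_col_invmx_R.
Qed.
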